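(* Let $T_1$ and $T_2$ be two finite oriented trees satisfying $T_1<T_2$ in the homomorphism order. If $T_2$ is a proper tree, then the interval $[T_1,T_2]$ is universal.
   Context: All digraphs are finite. A digraph $G$ is a pair $(V(G),A(G))$ with $V(G)$ a set of vertices and $A(G)$ a binary irreflexive relation on $V(G)$ (the arcs; the arc $(u,v)$ is written $uv$). A path is a digraph consisting of a sequence of different vertices $v_0,\dots,v_k$ together with a sequence of different arcs $e_1,\dots,e_k$ such that each $e_i$ is an arc joining $v_{i-1}$ and $v_i$ (in either direction, i.e. $e_i=v_{i-1}v_i$ or $e_i=v_iv_{i-1}$). A cycle is defined analogously but with $v_0=v_k$ (and $k\ge 1$); arcs may again be oriented in either direction. A tree (oriented tree) is a connected digraph (connectedness ignoring arc directions) containing no cycles. A homomorphism $f:G\to H$ of digraphs is a map $f:V(G)\to V(H)$ such that $uv\in A(G)$ implies $f(u)f(v)\in A(H)$. Write $G\le H$ if there is a homomorphism from $G$ to $H$, and $G<H$ if $G\le H$ and $H\not\le G$. Digraphs $G,H$ are homomorphically equivalent if $G\le H$ and $H\le G$. The relation $\le$ is a quasiorder on finite digraphs, which becomes a partial order (the homomorphism order) on homomorphic equivalence classes. The core of a digraph is its minimal homomorphically equivalent subgraph (unique up to isomorphism). An oriented tree is proper if its core is not a path. The interval $[G,H]$ consists of all finite digraphs $X$ with $G\le X\le H$, ordered by $\le$ (considered up to homomorphic equivalence). An embedding of a partial order $(\mathcal{P}_1,\le_1)$ into $(\mathcal{P}_2,\le_2)$ is a map $\Phi:\mathcal{P}_1\to\mathcal{P}_2$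 such that for all $a,b\in\mathcal{P}_1$, $a\le_1 b$ if and only if $\Phi(a)\le_2\Phi(b)$. A partial order is universal if every countable partial order can be embedded into it. *)

(* Defs.v *)
From Stdlib Require Relation_Definitions.
From mathcomp Require Import all_boot.

Set Implicit Arguments.
Unset Strict Implicit.
Unset Printing Implicit Defensive.

Record digraph := Digraph {
  vertex :> finType;
  arc : rel vertex;
  arc_irr : irreflexive arc
}.

Definition is_hom (G H : digraph) (f : G -> H) : Prop :=
  forall u v : G, arc u v -> arc (f u) (f v).

Definition hom_le (G H : digraph) : Prop := exists f : G -> H, is_hom f.

Definition hom_lt (G H : digraph) : Prop := hom_le G H /\ ~ hom_le H G.

Definition hom_equiv (G H : digraph) : Prop := hom_le G H /\ hom_le H G.

(* [walk x s es], with s = [:: v_1; ...; v_k] and es = [:: e_1; ...; e_k]: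
   every e_i is an arc of G joining v_(i-1) and v_i, in either direction,
   where v_0 = x. *)
Fixpoint walk (G : digraph) (x : G) (s : seq G) (es : seq (G * G)) : bool :=
  match s, es with
  | [::], [::] => true
  | y :: s', e :: es' =>
      [&& (e == (x, y)) || (e == (y, x)), arc e.1 e.2 & walk y s' es']
  | _, _ => false
  end.

(* The digraph G itself is a path; k = 0 (a single vertex) is allowed. *)
Definition is_path (G : digraph) : Prop :=
  exists (x : G) (s : seq G) (es : seq (G * G)),
    [/\ walk x s es, uniq (x :: s), uniq es,
        forall v : G, v \in x :: s
      & forall u v : G, arc u v -> (u, v) \in es].

(* Since the arcs, not only the vertices, are required to be different, two
   opposite arcs uv and vu form a cycle (k = 2), while going back and forth
   along a single arc does not. *)
Definition is_cycle (G : digraph) (x : G) (s : seq G) (es : seq (G * G)) : Prop :=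
  [/\ walk x s es, 1 <= size s, last x s = x, uniq s & uniq es].

Definition connected (G : digraph) : Prop :=
  forall u v : G, connect [rel x y : G | arc x y || arc y x] u v.

Definition is_tree (G : digraph) : Prop :=
  connected G /\
  forall (x : G) (s : seq G) (es : seq (G * G)), ~ is_cycle x s es.

(* Subgraphs need not be induced. *)
Record subgraph (G : digraph) := Subgraph {
  sub_verts : {set G};
  sub_arcs : {set G * G};
  sub_arcsP : forall u v : G, (u, v) \in sub_arcs ->
    [/\ u \in sub_verts, v \in sub_verts & arc u v]
}.

Definition sub_arc (G : digraph) (S : subgraph G) :
    rel {x : G | x \in sub_verts S} :=
  fun u v => (val u, val v) \in sub_arcs S.

Lemma sub_arc_irr (G : digraph) (S : subgraph G) : irreflexive (@sub_arc G S).
Proof.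
by move=> u; apply/negP => /sub_arcsP[_ _]; rewrite arc_irr.
Qed.

Coercion digraph_of_subgraph (G : digraph) (S : subgraph G) : digraph :=
  Digraph (@sub_arc_irr G S).

Definition subgraph_le (G : digraph) (S S' : subgraph G) : Prop :=
  (sub_verts S \subset sub_verts S') /\ (sub_arcs S \subset sub_arcs S').

Definition is_core (G : digraph) (C : subgraph G) : Prop :=
  hom_equiv C G /\
  forall D : subgraph G, hom_equiv D G -> subgraph_le D C -> subgraph_le C D.

(* A core exists and is unique up to isomorphism, so it does not matter that
   all cores of G are considered. *)
Definition proper_tree (G : digraph) : Prop :=
  is_tree G /\ forall C : subgraph G, is_core C -> ~ is_path C.

Definition interval (G H : digraph) : Type :=
  {X : digraph | hom_le G X /\ hom_le X H}.

Definition interval_le (G H : digraph) (X Y : interval G H) : Prop :=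
  hom_le (sval X) (sval Y).

Definition is_embedding (P Q : Type) (leP : P -> P -> Prop)
    (leQ : Q -> Q -> Prop) (f : P -> Q) : Prop :=
  forall a b : P, leP a b <-> leQ (f a) (f b).

Definition is_countable (P : Type) : Prop := exists f : P -> nat, injective f.

(* Here leQ may be a quasiorder. It stands for the partial order it induces on
   the classes of the equivalence "leQ a b and leQ b a", an embedding being
   given by representatives of the classes. *)
Definition universal (Q : Type) (leQ : Q -> Q -> Prop) : Prop :=
  forall (P : Type) (leP : P -> P -> Prop),
    Relation_Definitions.order P leP -> is_countable P ->
    exists f : P -> Q, is_embedding leP leQ f.

(* Main.v *)
From Stdlib Require Import ClassicalEpsilon.
From mathcomp Require Import all_boot zify.
Require Import Defs.

Set Implicit Arguments.
Unset Strict Implicit.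
Unset Printing Implicit Defensive.

(** Let T be a core of T2. It is a tree that is not a path, so it has a vertex r
    with three different neighbours s_0, s_1, s_2, the spokes; read the indices
    of spokes modulo 3. For N divisible by 3, the necklace of length N consists
    of N copies of T, joined cyclically at the edges between r and the spokes:
    the copy r_i of r keeps its edge to the i-th copy of s_i, is joined to the
    copy numbered i - 1 of s_(i-1), and has no edge at all to a copy of s_(i+1).
    Forgetting the numbers gives a homomorphism from the necklace to T.
    Conversely T does not map to a necklace (necklace_nle): composed with this
    projection a homomorphism would be an automorphism of T, so that some r_i
    would have neighbours over all three spokes.

    The heart of the proof is necklace_turn. Let f be a homomorphism from a
    necklace to a digraph H without opposite arcs to which T does not map. Then
    the image under f of the closed walk r_0, s_0, r_1, s_1, r_2, ... never turns
    back on itself. If it did, some vertex f(r_i) of H would be joined in the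
    right way to an image of the branch of T at each of its neighbours, including
    the missing spoke; these images would fit together to a homomorphism from T
    to H, since the branches of a tree at r meet only in r.

    A closed walk that never turns back does not exist in a tree (tour_tree), and
    in a necklace of length M it runs round the central cycle, hence M divides
    its number N of copies of r (tour_dvd). So the necklace of length N maps to
    the necklace of length M exactly if M divides N, and it does not map to T1.

    A finite set A of positive integers is now encoded by the disjoint union of
    T1 and the necklaces of length 3 a with a in A, which belongs to the interval.
    By the above, the encoding of A maps to that of B exactly if every element of
    A is a multiple of an element of B (encode_divle). This order on finite sets
    is universal (divle_universal): union is a join for it, pairwise least common
    multiples give a meet, and different primes are as independent as the
    generators of a free distributive lattice, so a countable order embeds into
    it one element after the other. *)

(** * Forests *)

Definition adj (G : digraph) : rel G := [rel x y : G | arc x y || arc y x].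

Definition adj_off (G : digraph) (v : G) : rel G :=
  [rel x y | [&& adj x y, x != v & y != v]].

Definition no_digon (G : digraph) := forall u v : G, arc u v -> ~~ arc v u.

(** Absence of cycles of length at least 3, in the form in which it is used and
    in which it passes to subgraphs: the branches at v of different neighbours
    of v meet only in v. *)
Definition separating (G : digraph) := forall v u w : G,
  adj v u -> adj v w -> connect (adj_off v) u w -> u = w.

Lemma adj_sym (G : digraph) : symmetric (@adj G).
Proof. by move=> x y; rewrite /adj /= orbC. Qed.

Lemma adj_neq (G : digraph) (u v : G) : adj u v -> u != v.
Proof. by case: eqP => // ->; rewrite /adj /= arc_irr. Qed.

Lemma adj_off_sym (G : digraph) (v : G) : symmetric (adj_off v).
Proof. by move=> x y; rewrite /adj_off /= adj_sym; congr (_ && _); rewrite andbC. Qed.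

Lemma hom_adj (G H : digraph) (f : G -> H) (u v : G) :
  is_hom f -> adj u v -> adj (f u) (f v).
Proof. by move=> fH /orP[] /fH uv; rewrite /adj /= uv ?orbT. Qed.

Lemma hom_le_refl (G : digraph) : hom_le G G.
Proof. by exists id. Qed.

Lemma hom_le_trans (H G K : digraph) : hom_le G H -> hom_le H K -> hom_le G K.
Proof. by move=> [f fH] [g gH]; exists (g \o f) => u v /fH/gH. Qed.

Lemma no_digon_hom (G H : digraph) : hom_le G H -> no_digon H -> no_digon G.
Proof. by move=> [f fH] nd u v /fH/nd; apply: contra => /fH. Qed.

Lemma connect_map (T U : finType) (e : rel T) (e' : rel U) (f : T -> U) (x y : T) :
  (forall a b, e a b -> e' (f a) (f b)) -> connect e x y -> connect e' (f x) (f y).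
Proof.
move=> ee' /connectP[p ep ->]; elim: p x ep => //= z p IHp x /andP[xz /IHp].
by apply: connect_trans; apply/connect1/ee'.
Qed.

Lemma separating_inj (G H : digraph) (f : G -> H) :
  is_hom f -> injective f -> separating H -> separating G.
Proof.
move=> fH fI sepH v u w vu vw uw; apply/fI.
apply: (sepH (f v)) (hom_adj fH vu) (hom_adj fH vw) _.
apply: connect_map uw => a b /and3P[ab av bv].
by rewrite /adj_off /= (hom_adj fH ab) !(inj_eq fI) av.
Qed.

Definition edge (G : digraph) (x y : G) := if arc x y then (x, y) else (y, x).

Fixpoint edges (G : digraph) (x : G) (s : seq G) : seq (G * G) :=
  if s is y :: s' then edge x y :: edges y s' else [::].

Lemma edge_arc (G : digraph) (x y : G) : adj x y -> arc (edge x y).1 (edge x y).2.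
Proof. by rewrite /adj /edge /=; case: ifP. Qed.

Lemma edge_ends (G : digraph) (x y z : G) :
  (z == (edge x y).1) || (z == (edge x y).2) = (z == x) || (z == y).
Proof. by rewrite /edge; case: ifP => //=; rewrite orbC. Qed.

Lemma walk_edges (G : digraph) (x : G) s : path (@adj G) x s -> walk x s (edges x s).
Proof.
elim: s x => //= y s IHs x /andP[xy /IHs->]; rewrite andbT (edge_arc xy) andbT.
by rewrite /edge; case: ifP; rewrite eqxx ?orbT.
Qed.

Lemma edges_rcons (G : digraph) (x y : G) s :
  edges x (rcons s y) = rcons (edges x s) (edge (last x s) y).
Proof. by elim: s x => //= z s IHs x; rewrite IHs. Qed.

Lemma edges_ends (G : digraph) (x z : G) s e : e \in edges x s ->
  (z == e.1) || (z == e.2) -> z \in x :: s.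
Proof.
elim: s x => //= y s IHs x; rewrite inE => /predU1P[->|/IHs es /es].
  by rewrite edge_ends !inE => /orP[] ->; rewrite ?orbT.
by rewrite [in X in _ -> X]inE orbC => ->.
Qed.

Lemma edge_notin_edges (G : digraph) (x y z w : G) s :
  z \notin y :: s -> (z == x) || (z == w) -> edge x w \notin edges y s.
Proof.
move=> zs zxw; apply: contra zs => /edges_ends; apply.
by rewrite edge_ends.
Qed.

Lemma uniq_edges (G : digraph) (x : G) s : uniq (x :: s) -> uniq (edges x s).
Proof.
elim: s x => // y s IHs x /= /andP[xs /IHs->]; rewrite andbT.
by apply: edge_notin_edges xs _; rewrite eqxx.
Qed.

Section Acyclic.
Variable G : digraph.
Hypothesis acyclic : forall (x : G) s es, ~ is_cycle x s es.

Lemma acyclic_no_digon : no_digon G.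
Proof.
move=> u v uv; apply/negP => vu.
have nuv : u != v by apply: adj_neq; rewrite /adj /= uv.
apply: (acyclic (x := u) (s := [:: v; u]) (es := [:: (u, v); (v, u)])).
split=> //=; first by rewrite !eqxx uv vu ?orbT.
  by rewrite inE eq_sym nuv.
by rewrite inE xpair_eqE (negPf nuv).
Qed.

(** A path between two neighbours of v that avoids v closes up to a cycle
    through v. *)
Lemma acyclic_separating : separating G.
Proof.
move=> v u w vu vw /connectP[q]; case/shortenP=> p pP pU _ {q} wE.
have vp : v \notin u :: p.
  have uv : u != v by rewrite eq_sym; apply: adj_neq.
  elim: p u uv pP {pU wE vu} => [|y p IHp] u uv; first by rewrite inE eq_sym.
  by case/andP=> /and3P[_ _ yv] /(IHp _ yv) vp; rewrite inE negb_or eq_sym uv.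
have pA : path (@adj G) u p by apply: sub_path pP => a b /and3P[].
case: (eqVneq u w) => // uw; exfalso.
apply: (acyclic (x := v) (s := rcons (u :: p) v) (es := edges v (rcons (u :: p) v))).
have uv : u != v by rewrite eq_sym; apply: adj_neq.
split; rewrite ?last_rcons //.
- by apply: walk_edges; rewrite rcons_path /= vu pA -wE adj_sym.
- by rewrite rcons_uniq vp.
rewrite edges_rcons rcons_uniq -/(edges _ _) /= inE negb_or -wE.
have wv_vu : edge w v != edge v u.
  apply: contraNneq uw => wv.
  by have := edge_ends v u u; rewrite -wv edge_ends eqxx orbT (negPf uv) orbF.
by rewrite wv_vu !(edge_notin_edges vp) ?uniq_edges // eqxx ?orbT.
Qed.

End Acyclic.

(** Such a d makes G a tree rooted at r: by the last clause at most one neighbour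
    of v, its parent, is not deeper than v. *)
Definition depth_at (G : digraph) (r : G) (d : G -> nat) :=
  [/\ forall v, (d v == 0) = (v == r),
      forall u v, adj u v -> d v <= (d u).+1
    & forall v u w, adj v u -> adj v w -> d u <= d v -> d w <= d v -> u = w].

Section Depth.
Variables (G : digraph) (r : G).

Fixpoint ball n : {set G} :=
  if n is n'.+1 then ball n' :|: [set v | [exists u in ball n', adj u v]]
  else [set r].

Lemma in_ballS n v :
  (v \in ball n.+1) = (v \in ball n) || [exists u in ball n, adj u v].
Proof. by rewrite [LHS]inE; congr (_ || _); rewrite inE. Qed.

Lemma ballS n u v : u \in ball n -> adj u v -> v \in ball n.+1.
Proof.
by move=> un uv; rewrite in_ballS; apply/orP; right; apply/exists_inP; exists u.
Qed.

Lemma in_ball : connected G -> forall v, exists n, v \in ball n.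
Proof.
move=> cG v; case/connectP: (cG r v) => p pP ->.
elim/last_ind: p pP => [|p x IHp] /=; first by exists 0; rewrite inE.
rewrite rcons_path /= last_rcons => /andP[/IHp[n pn] px].
by exists n.+1; apply: ballS px.
Qed.

(** The distance from r. If u and w are two neighbours of v at distance at most
    that of v, then shortest paths from u and from w to r avoid v. *)
Lemma depth_exists : connected G -> separating G -> exists d, depth_at r d.
Proof.
move=> cG sepG; pose d v := ex_minn (in_ball cG v); exists d.
have d_ball v : v \in ball (d v) by rewrite /d; case: ex_minnP.
have d_min v n : v \in ball n -> d v <= n by rewrite /d; case: ex_minnP => m _; apply.
have d0 v : (d v == 0) = (v == r).
  apply/eqP/eqP => [d0|->]; last by apply/eqP; rewrite -leqn0 d_min ?inE.
  by move: (d_ball v); rewrite d0 inE => /eqP.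
have to_root v u : u != v -> d u <= d v -> connect (adj_off v) u r.
  have [n] := ubnP (d u); elim: n u => // n IHn u un uv duv.
  case du: (d u) => [|k]; first by move/eqP: du; rewrite d0 => /eqP->.
  have := d_ball u; rewrite du in_ballS => /orP[uk|/exists_inP[x xk xu]].
    by have := d_min _ _ uk; rewrite du ltnn.
  have {}xk := d_min _ _ xk.
  have xv : x != v by apply: contraTneq duv => <-; rewrite du -ltnNge ltnS.
  apply: connect_trans (IHn x _ xv _).
  - by apply: connect1; rewrite /adj_off /= adj_sym xu uv.
  - by rewrite (leq_ltn_trans xk) // -du.
  by rewrite (leq_trans xk) // (leq_trans _ duv) // du.
split=> // [u v uv|v u w vu vw du dw]; first by apply: d_min; apply: ballS uv.
apply: (sepG v) => //; apply: (@connect_trans _ _ r).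
  by apply: to_root => //; rewrite eq_sym adj_neq.
rewrite (sym_connect_sym (@adj_off_sym _ v)).
by apply: to_root => //; rewrite eq_sym adj_neq.
Qed.

End Depth.

(** * Branching vertices and cores *)

Definition branching (G : digraph) (r : G) := exists b0 b1 b2 : G,
  [/\ adj r b0, adj r b1, adj r b2 & uniq [:: b0; b1; b2]].

Section Branching.
Variable G : digraph.
Hypotheses (cG : connected G) (sepG : separating G).

Lemma path_adj_off (x y : G) s :
  x \notin y :: s -> path (@adj G) y s -> path (adj_off x) y s.
Proof.
elim: s y => //= z s IHs y; rewrite [in X in X -> _]inE negb_or.
move=> /andP[xy xs] /andP[yz pzs].
rewrite IHs // /adj_off /= yz eq_sym xy andbT /=.
by apply: contraNneq xs => ->; rewrite mem_head.
Qed.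

(** A chord of the path would give one of its ends two neighbours that are
    joined by the rest of the path. *)
Lemma path_chord (x : G) s (u v : G) : path (@adj G) x s -> uniq (x :: s) ->
  u \in x :: s -> v \in x :: s -> adj u v ->
  (edge u v \in edges x s) || (edge v u \in edges x s).
Proof.
elim: s x u v => [|y s IHs] x u v.
  by rewrite !inE => _ _ /eqP-> /eqP-> /adj_neq; rewrite eqxx.
move=> /andP[xy pys] /andP[xs us].
have from_x w : w \in y :: s -> adj x w -> w = y.
  move=> ws xw; apply: esym; apply: (sepG xy xw).
  exact: path_connect (path_adj_off xs pys) _ ws.
rewrite inE => /predU1P[->|uys]; rewrite inE => /predU1P[->|vys] uv.
- by have := adj_neq uv; rewrite eqxx.
- by rewrite (from_x v) // inE eqxx.
- by rewrite adj_sym in uv; rewrite (from_x u) // !inE eqxx orbT.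
by rewrite !inE; case/orP: (IHs y u v pys us uys vys uv) => ->; rewrite !orbT.
Qed.

(** A path that does not cover the graph either extends at an end or has an
    inner vertex with a third neighbour. *)
Lemma branching_or_path : no_digon G -> forall (x : G) s,
  path (@adj G) x s -> uniq (x :: s) -> (exists r : G, branching r) \/ is_path G.
Proof.
move=> ndG x s; have [n] := ubnP (#|G| - size s).
elim: n x s => // n IHn x s sn pxs us.
have [all_s|] := boolP [forall v, v \in x :: s].
  right; exists x, s, (edges x s); split=> // [||v|u v uv].
  - exact: walk_edges.
  - exact: uniq_edges.
  - exact: (forallP all_s).
  have := path_chord pxs us (forallP all_s u) (forallP all_s v).
  rewrite /adj /= uv => /(_ isT).
  by rewrite /edge uv (negPf (ndG _ _ uv)) orbb.
rewrite negb_forall => /existsP[z zs].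
have [w [v [ws vs wv]]] : exists w v, [/\ w \in x :: s, v \notin x :: s & adj w v].
  case/connectP: (cG x z) => p pxp zE; rewrite {}zE in zs.
  have exit a : a \in x :: s -> path (@adj G) a p -> last a p \notin x :: s ->
    exists w v, [/\ w \in x :: s, v \notin x :: s & adj w v].
    elim: p a {pxp zs} => [|y p IHp] a ax /=; first by rewrite ax.
    case/andP=> ay pyp ys.
    by case: (boolP (y \in x :: s)) => [yx|yx]; [apply: (IHp y) | exists a, y].
  exact: exit (mem_head x s) pxp zs.
have size_s : (size s).+1 < #|G|.
  have <- : size (v :: x :: s) = (size s).+2 by [].
  by rewrite -(card_uniqP _) /= ?vs // max_card.
have shorter : #|G| - (size s).+1 < n.
  by rewrite -ltnS (leq_trans _ sn) // ltnS -subSn ?subSS //; apply: ltnW.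
move: ws; rewrite inE => /predU1P[wx|ws].
  rewrite wx adj_sym in wv; apply: (IHn v (x :: s)) => //=; first by rewrite wv.
  by rewrite vs.
case/splitPr: ws pxs us vs shorter {sn size_s} => s1 [|y s2].
  rewrite cats1 => pxs us vs shorter.
  apply: (IHn x (rcons (rcons s1 w) v)); first by rewrite size_rcons.
    by rewrite rcons_path last_rcons pxs.
  by rewrite -rcons_cons rcons_uniq vs.
rewrite cat_path => /and4P[_ lw wy _].
rewrite -cat_cons cat_uniq mem_cat negb_or => /and3P[_ /hasPn disj _] /andP[vl vr] _.
left; exists w, (last x s1), y, v; split=> //; first by rewrite adj_sym.
have lP : last x s1 \in x :: s1 by apply: mem_last.
have yP : y \in [:: w, y & s2] by rewrite !inE eqxx orbT.
rewrite /= !inE negb_or andbT -andbA; apply/and3P; split.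
- by apply: contraNneq (disj y yP) => <-.
- by apply: contraNneq vl => <-.
- by apply: contraNneq vr => <-.
Qed.

End Branching.

Section Core.
Variable G : digraph.

Definition sub_full : subgraph G.
Proof.
exists [set: G] [set e | arc e.1 e.2] => u v.
by rewrite !inE.
Defined.

Lemma sub_full_equiv : hom_equiv sub_full G.
Proof.
split; first by exists val => u v; rewrite /= /sub_arc inE.
exists (fun v => exist _ v (in_setT v)) => u v uv.
by rewrite /= /sub_arc inE.
Qed.

Lemma sub_val_hom (C : subgraph G) : is_hom (val : C -> G).
Proof. by move=> u v /sub_arcsP[]. Qed.

Lemma sub_hom_le (C : subgraph G) : hom_le C G.
Proof. by exists val; apply: sub_val_hom. Qed.

(** Descent on the number of vertices and arcs, starting from G itself. *)
Lemma core_exists : exists C : subgraph G, is_core C.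
Proof.
pose m (D : subgraph G) := #|sub_verts D| + #|sub_arcs D|.
have [n] := ubnP (m sub_full); have := sub_full_equiv.
elim: n sub_full => // n IHn D DG Dn.
case: (classic (is_core D)) => [|notcore]; first by exists D.
have [D' [D'G D'D nDD']] : exists D' : subgraph G,
     [/\ hom_equiv D' G, subgraph_le D' D & ~ subgraph_le D D'].
  apply: NNPP => no; apply: notcore; split=> // D' D'G D'D.
  by apply: NNPP => nDD'; apply: no; exists D'.
apply: (IHn D') => //; rewrite ltnS in Dn; apply: leq_trans Dn.
case: D'D => sv sa; rewrite ltn_neqAle leq_add ?subset_leq_card // andbT.
apply: contra_notN nDD' => /eqP eqm.
have [eqv eqa] : #|sub_verts D'| = #|sub_verts D| /\ #|sub_arcs D'| = #|sub_arcs D|.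
  by move: eqm (subset_leq_card sv) (subset_leq_card sa); rewrite /m; lia.
have /eqP sv' : sub_verts D' == sub_verts D by rewrite eqEcard sv eqv leqnn.
have /eqP sa' : sub_arcs D' == sub_arcs D by rewrite eqEcard sa eqa leqnn.
by rewrite /subgraph_le sv' sa' !subxx.
Qed.

End Core.

Lemma surj_inj (T : finType) (h : T -> T) :
  (forall v, exists u, h u = v) -> injective h.
Proof.
move=> surj; apply/injectiveP; rewrite /injectiveb /dinjectiveb.
rewrite (@uniq_size_uniq _ (enum T)) ?enum_uniq ?size_map // => v.
by have [u <-] := surj v; rewrite mem_enum inE map_f ?mem_enum.
Qed.

(** The property of a core that does not refer to the surrounding graph. *)
Definition endo_auto (G : digraph) := forall h : G -> G, is_hom h ->
  injective h /\
  forall x y : G, arc x y -> exists u v : G, [/\ arc u v, h u = x & h v = y].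

(** The image of an endomorphism of the core C is a subgraph of G to which G
    maps, so by minimality it is all of C. *)
Lemma core_endo (G : digraph) (C : subgraph G) : is_core C -> endo_auto C.
Proof.
case=> [[CG GC] minC] h hH.
pose V := [set val (h v) | v : C].
pose A := [set (val (h a.1), val (h a.2)) | a : C * C & arc a.1 a.2].
have DP u v : (u, v) \in A -> [/\ u \in V, v \in V & arc u v].
  case/imsetP=> -[x y]; rewrite inE /= => xy [-> ->].
  split; try by apply/imsetP; eexists.
  by case/sub_arcsP: (hH _ _ xy).
pose D := Subgraph DP.
have hV (v : C) : val (h v) \in sub_verts D by apply: imset_f.
have DG : hom_equiv D G.
  split; first exact: sub_hom_le.
  apply: hom_le_trans GC _; exists (fun v => exist _ (val (h v)) (hV v)) => u v uv.
  by apply/imsetP; exists (u, v); rewrite ?inE.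
have DC : subgraph_le D C.
  split; apply/subsetP=> e /imsetP[]; first by move=> v _ ->; apply: valP.
  by case=> x y + -> ; rewrite inE => /hH.
have [/subsetP sV /subsetP sA] := minC D DG DC; split.
  apply: surj_inj => v.
  by case/imsetP: (sV _ (valP v)) => u _ /val_inj->; exists u.
move=> x y xy; case/imsetP: (sA (val x, val y) xy) => -[u v].
by rewrite inE /= => uv [/val_inj-> /val_inj->]; exists u, v.
Qed.

(** The core is an image of G, since mapping G to C and restricting to C gives a
    surjection of C onto itself. *)
Lemma core_connected (G : digraph) (C : subgraph G) :
  is_core C -> connected G -> connected C.
Proof.
move=> coreC cG; case: (coreC) => [[_ [f fH]] _].
have hH : is_hom (f \o val : C -> C) by move=> u v /sub_val_hom/fH.
have [/injF_bij[k _ kK] _] := core_endo coreC hH.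
move=> u v; rewrite -(kK u) -(kK v) /=.
apply: (connect_map (f := f)) (cG _ _) => a b.
exact: hom_adj fH.
Qed.

(** * Necklaces *)

Section Necklace.
Variables (T : digraph) (r : T) (S : seq T).

Definition spoke (i : nat) : T := nth r S (i %% 3).

(** Only the edges between r and the spokes connect different copies of T: the
    copies i and i + 1 of r share the i-th copy of spoke i, and the other copies
    of that spoke are cut off from r. *)
Definition link N (x y : T * 'I_N) : bool :=
  let: (u, i) := x in let: (v, j) := y in
  if (u == r) && (v \in S) then (v == spoke j) && ((i == j) || (i == ordS j))
  else if (v == r) && (u \in S) then (u == spoke i) && ((j == i) || (j == ordS i))
  else i == j.

Arguments link : simpl never.

Definition necklace_arc N : rel (T * 'I_N) :=
  [rel x y | arc x.1 y.1 && link x y].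

Lemma necklace_irr N : irreflexive (@necklace_arc N).
Proof. by move=> x; rewrite /necklace_arc /= arc_irr. Qed.

Definition necklace N : digraph := Digraph (@necklace_irr N).

Lemma necklace_arcE N (x y : necklace N) : arc x y = arc x.1 y.1 && link x y.
Proof. by []. Qed.

Lemma necklace_hom N : is_hom (fst : necklace N -> T).
Proof. by move=> x y /andP[]. Qed.

Hypotheses (S3 : size S = 3) (S_uniq : uniq S) (S_adj : {in S, forall s, adj r s}).

Lemma spokeP i : spoke i \in S.
Proof. by rewrite mem_nth // S3 ltn_mod. Qed.

Lemma eq_spoke i j : (spoke i == spoke j) = (i == j %[mod 3]).
Proof. by rewrite nth_uniq // S3 ltn_mod. Qed.

Lemma spoke_cases v i : v \in S ->
  [|| v == spoke i, v == spoke i.+1 | v == spoke i.+2].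
Proof.
move=> vS; have iv : index v S < 3 by rewrite -S3 index_mem.
have -> : v = spoke (index v S) by rewrite /spoke modn_small // nth_index.
by rewrite !eq_spoke; lia.
Qed.

Lemma root_notin : r \notin S.
Proof. by apply/negP => /S_adj/adj_neq; rewrite eqxx. Qed.

Lemma spoke_neq s : s \in S -> (s == r) = false.
Proof. by apply: contraTF => /eqP->; apply: root_notin. Qed.

Lemma link_spoke N (i j : 'I_N) s : s \in S ->
  link (r, i) (s, j) = (s == spoke j) && ((i == j) || (i == ordS j)).
Proof. by move=> sS; rewrite /link eqxx sS. Qed.

Lemma link_sym N (x y : T * 'I_N) : link x y = link y x.
Proof.
case: x y => [u i] [v j]; rewrite /link.
have rS := negPf root_notin.
case: (eqVneq u r) => [->|ur]; case: (eqVneq v r) => [->|vr] /=;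
  rewrite ?rS //= eq_sym //.
by case: ifP => // _; apply: eq_sym.
by case: ifP => // _; apply: eq_sym.
Qed.

Lemma link_eq N (u v : T) (i j : 'I_N) : u != r -> u \notin S ->
  link (u, i) (v, j) = (i == j).
Proof. by move=> ur uS; rewrite /link (negPf ur) (negPf uS) andbF. Qed.

Lemma link_nonroot N (u v : T) (i j : 'I_N) : u != r -> v != r ->
  link (u, i) (v, j) = (i == j).
Proof. by move=> ur vr; rewrite /link (negPf ur) (negPf vr). Qed.

Lemma necklace_adj N (x y : necklace N) : adj x y = adj x.1 y.1 && link x y.
Proof.
by rewrite /adj /= /necklace_arc /= [link y x]link_sym -andb_orl.
Qed.

Section Turn.
Variable N : nat.
Hypothesis N3 : 3 %| N.

Lemma ordS_mod3 (i : 'I_N) : ordS i = i.+1 %[mod 3].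
Proof. by rewrite /= modn_dvdm. Qed.

Section Glue.
Hypothesis sepT : separating T.

(** The neighbour of r in the branch of v at r. *)
Definition side (v : T) : T :=
  odflt r [pick b | adj r b && connect (adj_off r) b v].

Lemma side_nbr v : adj r v -> side v = v.
Proof.
rewrite /side => rv; case: pickP => [b /andP[rb bv]|/(_ v)]; first exact: (sepT rb rv bv).
by rewrite rv connect0.
Qed.

Lemma side_edge u v : u != r -> v != r -> adj u v -> side u = side v.
Proof.
move=> ur vr uv; rewrite /side; congr odflt; apply: eq_pick => b /=.
have uv1 : connect (adj_off r) u v by apply: connect1; rewrite /adj_off /= uv ur.
by rewrite (same_connect_r (sym_connect_sym (@adj_off_sym _ r)) uv1).
Qed.

(** Off r every copy of a branch of T at r is intact, and different branches are
    joined only through r. So a homomorphism from T may send r to any vertex y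
    and use, for each branch, the copy k that suits y. *)
Lemma glue (H : digraph) (f : necklace N -> H) (y : H) (k : T -> 'I_N) : is_hom f ->
  (forall v, arc r v -> arc y (f (v, k v))) ->
  (forall v, arc v r -> arc (f (v, k v)) y) -> hom_le T H.
Proof.
move=> fH out inn.
exists (fun v => if v == r then y else f (v, k (side v))) => u v uv.
have Auv : adj u v by rewrite /adj /= uv.
case: (eqVneq u r) uv Auv => [->|ur] uv Auv; case: (eqVneq v r) uv Auv => [->|vr] uv Auv.
- by rewrite arc_irr in uv.
- by rewrite (side_nbr Auv); apply: out.
- by rewrite side_nbr 1?adj_sym //; apply: inn.
apply: fH; rewrite necklace_arcE uv (side_edge ur vr Auv).
by rewrite link_nonroot ?eqxx.
Qed.

(** For j = i + 1, the copy i of r lacks only an edge to spoke j. It gets one in H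
    if f identifies it with the copy j of r, or if f identifies the copy j of
    spoke j with the copy i of spoke i: in the latter case both spokes are joined
    to r in the same direction, since both are joined to the copy j of r, whose
    image would otherwise have arcs to and from their common image. Then T maps
    to H by glueing. *)
Lemma necklace_turn (H : digraph) (f : necklace N -> H) (i : 'I_N) :
  is_hom f -> no_digon H -> ~ hom_le T H ->
  f (r, i) != f (r, ordS i) /\
  f (spoke i, i) != f (spoke (ordS i), ordS i).
Proof.
move=> fH ndH nTH.
set j := ordS i; pose h := ord_pred i; have hi : ordS h = i by rewrite /h ord_predK.
have hi3 : i = h.+1 %[mod 3] by rewrite -[in LHS]hi ordS_mod3.
have ij3 : j = i.+1 %[mod 3] by rewrite ordS_mod3.
(* The copies of the branches at the spokes i - 1, i and i + 1. *)
pose k v := if v == spoke j then j else if v == spoke h then h else i.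
have kP v : adj r v -> v != spoke j -> link (r, i) (v, k v).
  move=> rv vj; rewrite /k (negPf vj).
  have vr : v != r by rewrite eq_sym adj_neq.
  case: eqP => [vh|/eqP vh].
    by rewrite link_spoke vh ?spokeP // eqxx hi eqxx orbT.
  case: (boolP (v \in S)) => vS; last by rewrite link_sym link_eq.
  rewrite link_spoke // !eqxx andbT; case/or3P: (spoke_cases h vS) => // vh'.
  - by rewrite vh' in vh.
  - by rewrite (eqP vh') eq_spoke hi3.
  - by rewrite (eqP vh') eq_spoke in vj; lia.
have fwd v (a b : 'I_N) : link (r, a) (v, b) -> arc r v -> arc (f (r, a)) (f (v, b)).
  by move=> ab rv; apply: fH; rewrite necklace_arcE /= rv.
have bwd v (a b : 'I_N) : link (r, a) (v, b) -> arc v r -> arc (f (v, b)) (f (r, a)).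
  by move=> ab rv; apply: fH; rewrite necklace_arcE /= rv link_sym.
have glue_j : (arc r (spoke j) -> arc (f (r, i)) (f (spoke j, j))) ->
    (arc (spoke j) r -> arc (f (spoke j, j)) (f (r, i))) -> False.
  move=> out inn; apply: nTH; apply: (glue (y := f (r, i)) (k := k) fH) => v.
    case: (eqVneq v (spoke j)) => [->|vj rv]; first by rewrite /k eqxx.
    by apply: fwd => //; apply: kP; rewrite // /adj /= rv.
  case: (eqVneq v (spoke j)) => [->|vj rv]; first by rewrite /k eqxx.
  by apply: bwd => //; apply: kP; rewrite // /adj /= rv orbT.
have link_same a : link (r, a) (spoke a, a) by rewrite link_spoke ?spokeP // !eqxx.
have link_next : link (r, j) (spoke i, i) by rewrite link_spoke ?spokeP // !eqxx orbT.
split; apply/eqP => e; apply: glue_j.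
- by rewrite e; apply: fwd.
- by rewrite e; apply: bwd.
- move=> rj; rewrite -e; case/orP: (S_adj (spokeP i)) => ri; first exact: fwd.
  by have := ndH _ _ (bwd _ _ _ link_next ri); rewrite e (fwd _ _ _ (link_same _ j) rj).
- move=> jr; rewrite -e; case/orP: (S_adj (spokeP i)) => ri; last exact: bwd.
  by have := ndH _ _ (fwd _ _ _ link_next ri); rewrite e (bwd _ _ _ (link_same _ j) jr).
Qed.

End Glue.

Lemma val_iter_ordS k (i : 'I_N) : iter k (@ordS N) i = (i + k) %% N :> nat.
Proof.
elim: k => [|k IHk]; first by rewrite addn0 modn_small.
by rewrite iterS /= IHk -addn1 modnDml -addnA addn1.
Qed.

(** The closed walk that runs once around the necklace. *)
Definition thread (i0 : 'I_N) (t : nat) : necklace N :=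
  let i := iter t./2 (@ordS N) i0 in if odd t then (spoke i, i) else (r, i).

Lemma thread_adj i0 t : adj (thread i0 t) (thread i0 t.+1).
Proof.
rewrite necklace_adj /thread /= uphalf_half; case: (odd t) => /=.
  by rewrite adj_sym S_adj ?spokeP // link_sym link_spoke ?spokeP // !eqxx orbT.
by rewrite S_adj ?spokeP // link_spoke ?spokeP // !eqxx.
Qed.

Lemma thread_period i0 t : thread i0 (t + N.*2) = thread i0 t.
Proof.
rewrite /thread oddD odd_double addbF halfD odd_double andbF add0n doubleK.
have -> // : iter (t./2 + N) (@ordS N) i0 = iter t./2 (@ordS N) i0.
by apply: ord_inj; rewrite !val_iter_ordS addnA modnDr.
Qed.

End Turn.
End Necklace.

Arguments link : simpl never.

(** * Closed walks without backtracking *)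

Definition tour (H : digraph) (x : nat -> H) (K : nat) :=
  [/\ forall t, adj (x t) (x t.+1), forall t, x t != x t.+2 & forall t, x (t + K) = x t].

Section Tour.
Variables (H : digraph) (x : nat -> H) (K : nat).
Hypotheses (K_gt0 : 0 < K) (x_tour : tour x K).

Lemma tour_mod t : x (t %% K) = x t.
Proof.
have [_ _ per] := x_tour; rewrite [in RHS](divn_eq t K) addnC.
by elim: (t %/ K) => [|k ->]; rewrite ?addn0 // mulSn addnCA [K + _]addnC per.
Qed.

(** A peak of the walk: neither the predecessor x t of x t.+1 nor its successor
    lies deeper. *)
Lemma tour_peak (d : H -> nat) : exists t, forall s, d (x s) <= d (x t.+1).
Proof.
have [_ _ per] := x_tour.
pose dx (i : 'I_K) := d (x i).
have [i _ imax] := @arg_maxnP _ (Ordinal K_gt0) xpredT dx isT.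
(* One period later, so that the peak has a predecessor. *)
exists (i + K.-1) => s; rewrite -addnS prednK // per -(tour_mod s).
exact: (imax (Ordinal (ltn_pmod s K_gt0)) isT).
Qed.

(** The deepest vertex of the walk would have two parents. *)
Lemma tour_tree (r : H) (d : H -> nat) : ~ depth_at r d.
Proof.
case=> _ _ dP; have [xA xN _] := x_tour; have [t tmax] := tour_peak d.
have /eqP[] := xN t.
by apply: (dP (x t.+1)); rewrite ?tmax // adj_sym.
Qed.

End Tour.

Section NecklaceTour.
Variables (T : digraph) (r : T) (S : seq T) (N M : nat).
Hypotheses (S3 : size S = 3) (S_uniq : uniq S) (S_adj : {in S, forall s, adj r s}).
Hypothesis N_gt0 : 0 < N.
Variable (d : T -> nat).
Hypothesis dP : depth_at r d.
Variable x : nat -> necklace r S M.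
Hypothesis x_tour : tour x N.*2.

Let linkE := necklace_adj S_adj.
Let period_gt0 : 0 < N.*2. Proof. by rewrite double_gt0. Qed.

(** A peak at depth 2 or more lies outside the roots and spokes, so both its
    neighbours on the walk are in its own copy of T and lie over its parent. *)
Lemma tour_near_root t : d (x t).1 <= 1.
Proof.
have [d0 dS dU] := dP; have [xA xN _] := x_tour.
have [m mmax] := tour_peak period_gt0 x_tour (fun y => d y.1).
apply: leq_trans (mmax t) _; rewrite leqNgt; apply/negP => deep.
have /eqP[] := xN m.
have := xA m; rewrite adj_sym linkE; have := xA m.+1; rewrite linkE.
have := mmax m; have := mmax m.+2.
case: (x m) (x m.+1) (x m.+2) deep => [u i] [v j] [w k] /= deep dw du.
move=> /andP[vw vwl] /andP[vu vul].
have vr : v != r by rewrite -d0; case: (d v) deep.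
have vS : v \notin S.
  apply: contraL deep => /S_adj/dS; rewrite -leqNgt.
  by have /eqP-> : d r == 0 by rewrite d0.
move: vwl vul; rewrite !(link_eq _ _ _ vr vS) => /eqP <- /eqP <-.
by rewrite (dU v u w).
Qed.

(** By the bound on the depth, both neighbours on the walk of a vertex over a
    neighbour v of r lie over r. They differ, which leaves only the copies of a
    spoke that are joined to two copies of r. *)
Lemma tour_on_cycle t : (x t).1 = r \/ exists j : 'I_M, x t = (spoke r S j, j).
Proof.
have [d0 dS dU] := dP; have [xA xN per] := x_tour.
rewrite -(per t) -(prednK period_gt0) addnS.
set m := t + _; case: (eqVneq (x m.+1).1 r) => [->|]; first by left.
have := xN m; have := xA m; rewrite adj_sym linkE; have := xA m.+1; rewrite linkE.
have := tour_near_root m; have := tour_near_root m.+1; have := tour_near_root m.+2.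
case: (x m) (x m.+1) (x m.+2) => [u i] [v j] [w k] /= dw dv du.
move=> /andP[vw vwl] /andP[vu vul] uw vr.
have dv1 : d v = 1 by apply/eqP; rewrite eqn_leq dv lt0n d0.
have dr : d r = 0 by apply/eqP; rewrite d0.
right; exists j; congr (_, _).
case: (boolP (v \in S)) => vS; last first.
  move: vwl vul uw; rewrite !(link_eq _ _ _ vr vS) => /eqP <- /eqP <-.
  by rewrite (dU v u w) ?eqxx ?dv1.
have ur : u = r by apply: (dU v); rewrite ?dv1 ?dr // adj_sym S_adj.
by move: vul; rewrite ur (link_sym S_adj) link_spoke // => /andP[/eqP].
Qed.

(** Two consecutive vertices of the walk outside the root would be copies of
    adjacent spokes in the same branch. *)
Lemma tour_alternates t : (x t).1 != r -> (x t.+1).1 = r.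
Proof.
have [xA _ _] := x_tour; have := xA t; rewrite linkE => /andP[xa xl] tr.
case: (tour_on_cycle t) => [tr'|[i xi]]; first by rewrite tr' eqxx in tr.
case: (tour_on_cycle t.+1) => [//|[j xj]].
move: xa xl tr; rewrite xi xj /= => sa sl sr.
have sr' : spoke r S j != r by rewrite (spoke_neq S_adj) ?spokeP.
by move: sl sa; rewrite link_nonroot // => /eqP <- /adj_neq; rewrite eqxx.
Qed.

Lemma tour_root_step t (i : 'I_M) : x t = (r, i) -> exists j i' : 'I_M,
  [/\ x t.+1 = (spoke r S j, j), x t.+2 = (r, i') &
      (i = j /\ i' = ordS j) \/ (i = ordS j /\ i' = j)].
Proof.
move=> xt; have [xA xN _] := x_tour.
have := xA t; rewrite linkE xt => /andP[/= a1 l1].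
have nr1 : (x t.+1).1 != r by rewrite eq_sym adj_neq.
have r2 := tour_alternates nr1.
case: (tour_on_cycle t.+1) => [r1|[j xj]]; first by rewrite r1 eqxx in nr1.
have := xA t.+1; have := xN t; rewrite linkE; case: (x t.+2) r2 => [u i'] /= -> ii'.
rewrite xj => /andP[_ /=]; rewrite link_sym // link_spoke ?spokeP // eqxx /= => l2.
move: l1; rewrite xj link_spoke ?spokeP // eqxx /= => l1.
exists j, i'; split=> //; move: ii'; rewrite xt.
case/orP: l1 => /eqP->; case/orP: l2 => /eqP->; rewrite ?eqxx //; by [left | right].
Qed.

Lemma tour_root_next t (j : 'I_M) : x t.+1 = (spoke r S j, j) ->
  (x t = (r, j) -> x t.+2 = (r, ordS j)) /\ (x t = (r, ordS j) -> x t.+2 = (r, j)).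
Proof.
move=> xj; have [_ xN _] := x_tour.
split=> xt; have [a [b [xa xb ab]]] := tour_root_step xt;
  have ja : j = a by move: xa; rewrite xj => -[].
- by have := xN t; rewrite xt xb ja; case: ab => -[e ->] //; rewrite eqxx.
by have := xN t; rewrite xt xb ja; case: ab => -[e ->] //; rewrite eqxx.
Qed.

Lemma tour_spoke_next t (j : 'I_M) : x t.+1 = (spoke r S j, j) ->
  (x t.+2 = (r, ordS j) -> x t.+3 = (spoke r S (ordS j), ordS j)) /\
  (x t.+2 = (r, j) -> exists2 k : 'I_M, j = ordS k & x t.+3 = (spoke r S k, k)).
Proof.
move=> xj; have [_ xN _] := x_tour.
split=> xt; have [a [b [xa xb ab]]] := tour_root_step xt; have := xN t.+1;
  rewrite xj xa; move: ab => [] [e _].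
- by rewrite e.
- by rewrite (ordS_inj e) eqxx.
- by rewrite e eqxx.
by exists a.
Qed.

(** The walk runs round the necklace in a constant direction, so its N steps
    from root to root amount to a multiple of M. *)
Lemma tour_dvd : M %| N.
Proof.
have [xA xN per] := x_tour.
have [t [i xt]] : exists t (i : 'I_M), x t = (r, i).
  case: (eqVneq (x 0).1 r) => [x0|/tour_alternates x1].
    by exists 0, (x 0).2; rewrite -x0 -surjective_pairing.
  by exists 1, (x 1).2; rewrite -x1 -surjective_pairing.
have round (k : 'I_M) : iter N (@ordS M) k = k -> M %| N.
  move/(congr1 (@nat_of_ord M)); rewrite val_iter_ordS => kN.
  suff : k + N == k + 0 %[mod M] by rewrite eqn_modDl mod0n.
  by rewrite addn0 kN modn_small.
have [j [_ [xj _ [] [ij _]]]] := tour_root_step xt; rewrite ij in xt.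
- have fwd k : let j' := iter k (@ordS M) j in
    x (t + k.*2) = (r, j') /\ x (t + k.*2).+1 = (spoke r S j', j').
    elim: k => [|k [xk xk1]]; first by rewrite addn0.
    rewrite doubleS !addnS iterS.
    have xk2 := (tour_root_next xk1).1 xk.
    by rewrite xk2 ((tour_spoke_next xk1).1 xk2).
  by apply: (round j); have [] := fwd N; rewrite per xt => -[].
have bwd k : exists j', [/\ iter k (@ordS M) j' = j, x (t + k.*2) = (r, ordS j') &
    x (t + k.*2).+1 = (spoke r S j', j')].
  elim: k => [|k [j' [<- xk xk1]]]; first by exists j; rewrite addn0.
  rewrite doubleS !addnS; have xk2 := (tour_root_next xk1).2 xk.
  have [j'' jj xk3] := (tour_spoke_next xk1).2 xk2.
  by exists j''; rewrite xk2 iterSr jj.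
have [j' [jE]] := bwd N; rewrite per xt => /(congr1 snd)/ordS_inj jj _.
by apply: (round j'); rewrite jE jj.
Qed.

End NecklaceTour.

(** * Homomorphisms from and to necklaces *)

Section NecklaceOrder.
Variables (T : digraph) (r : T) (S : seq T).
Hypotheses (S3 : size S = 3) (S_uniq : uniq S) (S_adj : {in S, forall s, adj r s}).

Lemma necklace_le N M : 0 < M -> 3 %| M -> M %| N ->
  hom_le (necklace r S N) (necklace r S M).
Proof.
move=> M_gt0 M3 MN; pose g (i : 'I_N) : 'I_M := Ordinal (ltn_pmod i M_gt0).
have gS i : g (ordS i) = ordS (g i).
  by apply: ord_inj; rewrite /= modn_dvdm // -addn1 -modnDml addn1.
have spoke_g i : spoke r S (g i) = spoke r S i by rewrite /spoke /= modn_dvdm.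
have cond (i j : 'I_N) : (i == j) || (i == ordS j) -> (g i == g j) || (g i == ordS (g j)).
  by case/orP=> /eqP->; rewrite ?gS eqxx ?orbT.
exists (fun x => (x.1, g x.2)) => -[u i] [v j]; rewrite !necklace_arcE /= => /andP[->].
rewrite /link !spoke_g; case: ifP => _; first by case/andP=> -> /cond.
by case: ifP => _; [case/andP=> -> /cond | move/eqP->; rewrite eqxx].
Qed.

(** A homomorphism T -> necklace, followed by the projection, would be an
    automorphism of T; but no copy of r has neighbours over all three spokes. *)
Lemma necklace_nle N : 3 %| N -> endo_auto T -> ~ hom_le T (necklace r S N).
Proof.
move=> N3 endo [h hH].
have [|pI pA] := endo (fun v => (h v).1); first by move=> u v /hH/necklace_hom.
have pAdj x y : adj x y -> exists u v, [/\ adj u v, (h u).1 = x & (h v).1 = y].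
  case/orP=> /pA[u [v [uv <- <-]]]; first by exists u, v; rewrite /adj /= uv.
  by exists v, u; rewrite /adj /= uv orbT.
have [c [_ [_ cr _]]] := pAdj _ _ (S_adj (spokeP r S3 0)).
set i := (h c).2; pose s := spoke r S i.+1; have sS : s \in S := spokeP r S3 _.
have [u [v [uv ur vs]]] := pAdj _ _ (S_adj sS).
have := hom_adj hH uv; rewrite (pI u c) ?ur ?cr // necklace_adj // => /andP[_].
rewrite (surjective_pairing (h c)) (surjective_pairing (h v)) cr vs link_spoke // -/i.
rewrite eq_spoke // => /andP[ij ji]; have := ordS_mod3 N3 (h v).2.
by case/orP: ji ij => /eqP->; lia.
Qed.

Lemma necklace_tour (H : digraph) N (f : necklace r S N -> H) (i : 'I_N) :
  3 %| N -> separating T -> is_hom f -> no_digon H -> ~ hom_le T H ->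
  tour (fun t => f (thread r S i t)) N.*2.
Proof.
move=> N3 sepT fH ndH nTH; split=> t.
- by apply: (hom_adj fH); apply: thread_adj.
- rewrite /thread /= negbK; set j := iter _ _ _.
  by have [fr fs] := necklace_turn S3 S_uniq S_adj N3 sepT j fH ndH nTH; case: ifP.
by rewrite thread_period.
Qed.

End NecklaceOrder.

(** * Disjoint unions *)

Section Union.
Variables G H : digraph.

Definition dsum_arc : rel (G + H) := fun x y =>
  match x, y with
  | inl u, inl v => arc u v
  | inr u, inr v => arc u v
  | _, _ => false
  end.

Lemma dsum_irr : irreflexive dsum_arc.
Proof. by case=> x /=; rewrite arc_irr. Qed.

Definition dsum : digraph := Digraph dsum_irr.

Lemma dsum_le (K : digraph) : hom_le G K -> hom_le H K -> hom_le dsum K.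
Proof.
move=> [f fH] [g gH]; exists (fun x => match x with inl u => f u | inr v => g v end).
by case=> u [] v //=; [apply: fH | apply: gH].
Qed.

Lemma dsum_inl : hom_le G dsum.
Proof. by exists inl. Qed.

Lemma dsum_inr : hom_le H dsum.
Proof. by exists inr. Qed.

Definition is_left (x : dsum) := if x is inl _ then true else false.

Lemma adj_dsum (x y : dsum) : adj x y -> is_left x = is_left y.
Proof. by case: x y => u [] v. Qed.

Lemma dsum_left (I : Type) (f : I -> dsum) : (forall i, is_left (f i)) ->
  exists g : I -> G, forall i, f i = inl (g i).
Proof.
move=> L; have L' i : {v | f i = inl v} by have := L i; case: (f i) => // v _; exists v.
by exists (fun i => sval (L' i)) => i; exact: svalP (L' i).
Qed.

Lemma dsum_right (I : Type) (f : I -> dsum) : (forall i, ~~ is_left (f i)) ->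
  exists g : I -> H, forall i, f i = inr (g i).
Proof.
move=> R; have R' i : {v | f i = inr v} by have := R i; case: (f i) => // v _; exists v.
by exists (fun i => sval (R' i)) => i; exact: svalP (R' i).
Qed.

Lemma le_dsum (K : digraph) : connected K -> hom_le K dsum -> hom_le K G \/ hom_le K H.
Proof.
move=> cK [f fH].
have same u v : is_left (f u) = is_left (f v).
  case/connectP: (cK u v) => p + ->; elim: p u => //= w p IHp u /andP[uw /IHp <-].
  exact/adj_dsum/(hom_adj fH).
have [/forallP/dsum_left[g gE]|] := boolP [forall u, is_left (f u)].
  by left; exists g => u v /fH; rewrite !gE.
rewrite negb_forall => /existsP[u0 nL].
have [u|g gE] := @dsum_right _ f; first by rewrite (same u u0).
by right; exists g => u v /fH; rewrite !gE.
Qed.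

Lemma dsum_tour (x : nat -> dsum) K : tour x K ->
  (exists y : nat -> G, tour y K) \/ (exists y : nat -> H, tour y K).
Proof.
case=> xA xN xP.
have same t : is_left (x t) = is_left (x 0).
  by elim: t => // t <-; rewrite (adj_dsum (xA t)).
case x0: (is_left (x 0)); [left | right].
- have [t|y yE] := @dsum_left _ x; first by rewrite same x0.
  exists y; split=> t; last by have := xP t; rewrite !yE => -[].
    by have := xA t; rewrite !yE.
  by have := xN t; rewrite !yE.
have [t|y yE] := @dsum_right _ x; first by rewrite same x0.
exists y; split=> t; last by have := xP t; rewrite !yE => -[].
  by have := xA t; rewrite !yE.
by have := xN t; rewrite !yE.
Qed.

End Union.

(** * A universal order on finite sets of numbers *)

Definition divle (A B : seq nat) := all (fun a => has (fun b => b %| a) B) A.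

(** A meet for divle; the corresponding join is concatenation. *)
Definition lcms (A B : seq nat) := [seq lcmn a b | a <- A, b <- B].

Lemma divleP A B : reflect (forall a, a \in A -> exists2 b, b \in B & b %| a) (divle A B).
Proof. by apply: (iffP allP) => AB a /AB /hasP. Qed.

Lemma divle_refl : reflexive divle.
Proof. by move=> A; apply/divleP => a aA; exists a. Qed.

Lemma divle_lcms C A B : divle C (lcms A B) = divle C A && divle C B.
Proof.
apply/divleP/andP => [CAB|[/divleP CA /divleP CB] c cC].
  by split; apply/divleP => c /CAB[_ /allpairsP[[a b] [aA bB ->]]];
    rewrite dvdn_lcm => /andP[ac bc]; [exists a | exists b].
have [[a aA ac] [b bB bc]] := (CA c cC, CB c cC).
by exists (lcmn a b); [apply: allpairs_f | rewrite dvdn_lcm ac].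
Qed.

Lemma divle_foldr C A Bs :
  divle C (foldr lcms A Bs) = divle C A && all (divle C) Bs.
Proof. by elim: Bs => [|B Bs IH] /=; rewrite ?andbT // divle_lcms IH andbCA. Qed.

Section Universal.
Variable R : rel nat.
Hypotheses (R_refl : reflexive R) (R_trans : transitive R).

Fixpoint gen_prime n : nat :=
  if n is n'.+1 then sval (prime_above (gen_prime n')) else 2.

Lemma gen_prime_prime n : prime (gen_prime n).
Proof. by case: n => [|n] //=; case: prime_above. Qed.

Lemma gen_prime_inj : injective gen_prime.
Proof.
have mono : {homo gen_prime : m n / m < n}.
  apply: homo_ltn => [n m k|n]; first exact: ltn_trans.
  by rewrite /=; case: prime_above.
move=> m n e; have [mn|nm|//] := ltngtP m n.
  by have := mono _ _ mn; rewrite e ltnn.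
by have := mono _ _ nm; rewrite e ltnn.
Qed.

(** With joins for sums and meets for products, the code of n is
    (x_n + sum of the codes of the i < n below n) * (product of the codes of the
    i < n above n), where x_n is the n-th generator, a prime. The sum makes the
    code of n large enough and the product makes it small enough; the generator
    keeps it from being comparable to more codes than necessary. *)
Definition code_step n (c : nat -> seq nat) : seq nat :=
  foldr lcms (gen_prime n :: flatten [seq c i | i <- iota 0 n & R i n])
    [seq c i | i <- iota 0 n & R n i].

Fixpoint codes n : nat -> seq nat :=
  if n is n'.+1 then fun k => if k < n' then codes n' k else code_step n' (codes n')
  else fun=> [::].

Definition code n := codes n.+1 n.

Lemma eq_code_step n c c' :
  (forall i, i < n -> c i = c' i) -> code_step n c = code_step n c'.
Proof.
move=> cc; have E P : [seq c i | i <- iota 0 n & P i] = [seq c' i | i <- iota 0 n & P i].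
  by apply/eq_in_map => i; rewrite mem_filter mem_iota => /and3P[_ _ /cc].
by rewrite /code_step !E.
Qed.

Lemma codeE n : code n = code_step n code.
Proof.
rewrite [LHS]/code /= ltnn; apply: eq_code_step => i.
elim: n => // n IHn; rewrite ltnS leq_eqVlt => /predU1P[->|i_n] //=.
by rewrite i_n IHn.
Qed.

Lemma code_gt0 n a : a \in code n -> 0 < a.
Proof.
elim/ltn_ind: n a => n IHn; rewrite codeE /code_step.
have: forall B, B \in [seq code i | i <- iota 0 n & R n i] -> {in B, forall a, 0 < a}.
  move=> B /mapP[i]; rewrite mem_filter mem_iota => /and3P[_ _ /= i_n] -> a.
  exact: IHn.
elim: [seq _ | i <- _ & R n i] => [|B Bs IHB] Bpos a /=.
  rewrite inE => /predU1P[->|/flatten_mapP[i]].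
    exact: prime_gt0 (gen_prime_prime n).
  by rewrite mem_filter mem_iota => /and3P[_ _ /= i_n]; apply: IHn.
case/allpairsP=> -[b c] [/= bB cB ->]; rewrite lcmn_gt0 (Bpos B) ?inE ?eqxx //=.
by apply: IHB cB => B' B'Bs; apply: Bpos; rewrite inE B'Bs orbT.
Qed.

(** A set A of numbers is read as a monotone Boolean formula in disjunctive normal
    form: a number stands for the conjunction of the generators that divide it.
    The valuation of p makes the generator k true exactly if p is below k. *)
Definition holds p a := forall k, gen_prime k %| a -> R p k.

Definition true_at p (A : seq nat) := exists2 a, a \in A & holds p a.

Lemma true_at_mono p A B : divle A B -> true_at p A -> true_at p B.
Proof.
move/divleP=> AB [a /AB[b bB ba] pa]; exists b => // k kb.
by apply: pa; apply: dvdn_trans ba.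
Qed.

Lemma true_at_foldr p A Bs :
  true_at p A -> (forall B, B \in Bs -> true_at p B) -> true_at p (foldr lcms A Bs).
Proof.
move=> pA; elim: Bs => //= B Bs IHB pBs.
have [b bB pb] := pBs B (mem_head _ _).
have [|a aA pa] := IHB; first by move=> C CBs; apply: pBs; rewrite inE CBs orbT.
exists (lcmn b a); first exact: allpairs_f.
move=> k kab; have : gen_prime k %| b * a.
  by rewrite -muln_lcm_gcd dvdn_mulr.
by rewrite Euclid_dvdM ?gen_prime_prime // => /orP[/pb|/pa].
Qed.

(** So the valuation of p separates the code of p from that of every n which is
    not above p. *)
Lemma true_at_code p n : true_at p (code n) <-> R p n.
Proof.
elim/ltn_ind: n => n IHn; rewrite codeE; split=> [pn|pn].
  have : divle (code_step n code)
      (gen_prime n :: flatten [seq code i | i <- iota 0 n & R i n]).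
    have := divle_refl (code_step n code).
    by rewrite {2}/code_step divle_foldr => /andP[].
  move/true_at_mono/(_ pn) => [a]; rewrite inE => /predU1P[-> |/flatten_mapP[i]].
    by move=> /(_ n (dvdnn _)).
  rewrite mem_filter mem_iota => /and3P[i_n _ /= lt_in] ai pa.
  by apply: R_trans i_n; apply/IHn => //; exists a.
apply: true_at_foldr => [|B /mapP[i]].
  exists (gen_prime n); first exact: mem_head.
  move=> k; rewrite dvdn_prime2 ?gen_prime_prime // => /eqP/gen_prime_inj->.
  exact: pn.
rewrite mem_filter mem_iota => /and3P[ni _ /= lt_in] ->.
by apply/IHn => //; apply: R_trans ni.
Qed.

Lemma code_mono m n : R m n -> divle (code m) (code n).
Proof.
have [k] := ubnP (m + n); elim: k m n => // k IHk m n mnk mn.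
have [lt_mn|lt_nm|->] := ltngtP m n; last exact: divle_refl.
  rewrite [code n]codeE divle_foldr; apply/andP; split.
    apply/divleP => a am; exists a => //; rewrite inE; apply/orP; right.
    by apply/flatten_mapP; exists m; rewrite ?mem_filter ?mn ?mem_iota.
  apply/allP => _ /mapP[i + ->]; rewrite mem_filter mem_iota => /and3P[ni _ /= lt_in].
  by apply: IHk; [lia | apply: R_trans ni].
have := divle_refl (code m); rewrite {2}codeE divle_foldr => /andP[_ /allP]; apply.
by apply: map_f; rewrite mem_filter mn mem_iota.
Qed.

Lemma code_le m n : divle (code m) (code n) <-> R m n.
Proof.
split=> [mn|]; last exact: code_mono.
by apply/true_at_code/(true_at_mono mn)/true_at_code.
Qed.

End Universal.

Lemma divle_universal (P : Type) (leP : P -> P -> Prop) :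
  Relation_Definitions.order P leP -> is_countable P ->
  exists c : P -> seq nat, (forall p a, a \in c p -> 0 < a) /\
    (forall p q, leP p q <-> divle (c p) (c q)).
Proof.
case=> refl trans _ [f fI].
(* The order is carried over to nat, where the other numbers are isolated. *)
pose R' i j := i = j \/ exists p q, [/\ f p = i, f q = j & leP p q].
pose R i j : bool := if excluded_middle_informative (R' i j) then true else false.
have RP i j : reflect (R' i j) (R i j).
  by rewrite /R; case: excluded_middle_informative => h; constructor.
have R_refl : reflexive R by move=> i; apply/RP; left.
have R_trans : transitive R.
  move=> j i k /RP ij /RP jk; apply/RP.
  case: ij jk => [->//|[p [q [<- <- pq]]]] [<-|[q' [s [/fI-> <- qs]]]]; right.
    by exists p, q.
  by exists p, s; split=> //; apply: trans qs.
exists (fun p => code R (f p)); split=> [p a|p q]; first exact: code_gt0.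
rewrite code_le //; split=> [pq|/RP[/fI->//|[p' [q' [/fI-> /fI->]]]] //].
by apply/RP; right; exists p, q.
Qed.

(** * The interval *)

Section Encoding.
Variables (T1 T : digraph) (r : T) (S : seq T).

Fixpoint encode (A : seq nat) : digraph :=
  if A is a :: A' then dsum (necklace r S (3 * a)) (encode A') else T1.

Lemma le_encode A : hom_le T1 (encode A).
Proof.
elim: A => [|a A IHA] /=; first exact: hom_le_refl.
exact: hom_le_trans IHA (dsum_inr _ _).
Qed.

Lemma necklace_le_encode A a : a \in A -> hom_le (necklace r S (3 * a)) (encode A).
Proof.
elim: A => //= b A IHA; rewrite inE => /predU1P[->|/IHA aA]; first exact: dsum_inl.
exact: hom_le_trans aA (dsum_inr _ _).
Qed.

Lemma encode_le A K : hom_le T1 K ->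
  (forall a, a \in A -> hom_le (necklace r S (3 * a)) K) -> hom_le (encode A) K.
Proof.
move=> T1K; elim: A => //= a A IHA AK; apply: dsum_le.
  by apply: AK; rewrite inE eqxx.
by apply: IHA => b bA; apply: AK; rewrite inE bA orbT.
Qed.

Hypotheses (S3 : size S = 3) (S_uniq : uniq S) (S_adj : {in S, forall s, adj r s}).
Hypotheses (cT : connected T) (sepT : separating T) (ndT : no_digon T).
Hypothesis endoT : endo_auto T.
Hypotheses (T1_tree : is_tree T1) (T1_le : hom_le T1 T) (T_nle : ~ hom_le T T1).

Lemma encode_le_core A : hom_le (encode A) T.
Proof. by apply: encode_le => // a _; exists fst; apply: necklace_hom. Qed.

Lemma core_nle_encode A : ~ hom_le T (encode A).
Proof.
elim: A => //= a A IHA /(le_dsum cT)[] //.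
by apply: necklace_nle; rewrite ?dvdn_mulr.
Qed.

Lemma encode_tour A N (x : nat -> encode A) : 0 < N -> tour x N.*2 ->
  exists2 a, a \in A & 3 * a %| N.
Proof.
move=> N0; elim: A x => [|a A IHA] x /= xT.
  have [t0 _] : exists t0 : T1, True by exists (x 0).
  have [d dP] := depth_exists t0 T1_tree.1 (acyclic_separating T1_tree.2).
  by case: (@tour_tree _ x N.*2 _ xT _ _ dP); rewrite double_gt0.
case: (dsum_tour xT) => -[y yT]; last first.
  by case: (IHA y yT) => b bA; exists b; rewrite // inE bA orbT.
exists a; first by rewrite inE eqxx.
have [d dP] := depth_exists r cT sepT.
exact: (tour_dvd S3 S_adj N0 dP yT).
Qed.

Lemma encode_divle A B : (forall a, a \in A -> 0 < a) -> (forall b, b \in B -> 0 < b) ->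
  divle A B <-> hom_le (encode A) (encode B).
Proof.
move=> A0 B0; split=> [/divleP AB|AB].
  apply: encode_le => [|a /AB[b bB ba]]; first exact: le_encode.
  apply: hom_le_trans (necklace_le_encode bB).
  apply: necklace_le; [by rewrite muln_gt0 (B0 b) | exact: dvdn_mulr |].
  by rewrite dvdn_pmul2l.
apply/divleP => a aA; have [f fH] := hom_le_trans (necklace_le_encode aA) AB.
have N0 : 0 < 3 * a by rewrite muln_gt0 (A0 a).
have ndB : no_digon (encode B) := no_digon_hom (encode_le_core B) ndT.
have f_tour := necklace_tour S3 S_uniq S_adj (Ordinal N0) (dvdn_mulr a (dvdnn 3)) sepT
  fH ndB (@core_nle_encode B).
have [b bB ba] := encode_tour N0 f_tour; exists b => //.
by move: ba; rewrite dvdn_pmul2l.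
Qed.

End Encoding.

Theorem theorem1p2 (T1 T2 : digraph) (tree1 : is_tree T1) (tree2 : is_tree T2)
    (T1_lt_T2 : hom_lt T1 T2) (proper2 : proper_tree T2) :
  universal (@interval_le T1 T2).
Proof.
have [T C_T2] := core_exists T2; have [[TT2 T2T] _] := C_T2.
have [[c2 acyc2] [T12 T21]] := (tree2, T1_lt_T2).
have cT := core_connected C_T2 c2.
have sepT : separating T.
  exact: separating_inj (@sub_val_hom _ T) val_inj (acyclic_separating acyc2).
have ndT : no_digon T := no_digon_hom TT2 (acyclic_no_digon acyc2).
have TT1 : ~ hom_le T T1 by move=> /(hom_le_trans T2T).
(* The empty graph would map to T1. *)
have [v0 _|T_empty] := pickP (@predT T); last first.
  have no_vertex (v : T) : False by have := T_empty v.
  by case: TT1; exists (fun v => False_rect _ (no_vertex v)) => v; case: (no_vertex v).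
case: (branching_or_path cT sepT ndT (x := v0) (s := [::]) isT isT); last first.
  by move=> pT; case: (proper2.2 T C_T2).
case=> r [b0 [b1 [b2 [rb0 rb1 rb2 bU]]]]; set S := [:: b0; b1; b2] in bU.
have S_adj : {in S, forall s, adj r s} by move=> s; rewrite !inE => /or3P[] /eqP->.
have T1T : hom_le T1 T := hom_le_trans T12 T2T.
move=> P leP ordP cntP; have [c [c_gt0 cP]] := divle_universal ordP cntP.
have inI p : hom_le T1 (encode T1 r S (c p)) /\ hom_le (encode T1 r S (c p)) T2.
  split; first exact: le_encode.
  by apply: hom_le_trans TT2; apply: encode_le_core.
exists (fun p => exist _ (encode T1 r S (c p)) (inI p) : interval T1 T2) => p q.
rewrite /interval_le /= cP.
by apply: encode_divle => //; [apply: core_endo | apply: c_gt0 | apply: c_gt0].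
Qed.
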